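(* Consider the generalized Nash equilibrium problem in which each player $i\in\{1,\dots,N\}$ solves $\min_{a_i}J_i(a_i,a_{-i})$ subject to $g_i(a_i,a_{-i})\le0$, where $J_i:\mathbb{R}^n\to\mathbb{R}$ and $g_i:\mathbb{R}^n\to\mathbb{R}^{m_i}$ are, for every $i$, twice continuously differentiable with Lipschitz continuous second-order derivatives. Let $\Phi:\mathbb{R}^{n+m}\to\mathbb{R}^{n+m}$ be the associated KKT function formed with the min complementarity function, and let $z^*=(a^*,\lambda^* )$ be a quasi-regular solution of $\Phi(z)=0$. Then there exist $\delta_z>0$, $\delta_r>0$, $L_z<\infty$ and $L_r<\infty$ such that for every $z^0\in\mathbf{B}(z^*,\delta_z)$ and every disturbance sequence $\mathbf{r}=\{r^k\}_{k\ge0}$ in $\mathbb{R}^{n+m}$ with $\|\mathbf{r}\|_\infty=\sup_{k}\|r^k\|<\delta_r$, the sequence $\{z^k\}$ generated by the perturbed semismooth Newton method, in which $z^{k+1}$ is the solution $z$ of $$\Phi(z^k)+J\Phi(z^k)(z-z^k)=r^k,\qquad J\Phi(z^k)\in\mathrm{Jac}\,\Phi(z^k),$$ satisfies, for all $k\ge 0$, $$\|z^{k+1}-z^*\|\le L_z\|z^k-z^*\|^2+L_r\|r^k\|.$$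
   Context: Here $a=(a_1,\dots,a_N)=(a_i,a_{-i})\in\mathbb{R}^n$ with $a_i\in\mathbb{R}^{n_i}$, $n=\sum_i n_i$; $\lambda=(\lambda_1,\dots,\lambda_N)\in\mathbb{R}^m$ with $\lambda_i\in\mathbb{R}^{m_i}$, $m=\sum_i m_i$; and $z=(a,\lambda)$. The Lagrangian of player $i$ is $L_i(a,\lambda_i)=J_i(a)+\lambda_i^Tg_i(a)$, and $\mathbf{L}(z)=\mathbf{L}(a,\lambda)=(\nabla_{a_1}L_1(a,\lambda_1),\dots,\nabla_{a_N}L_N(a,\lambda_N))\in\mathbb{R}^n$. With the complementarity function $\phi(x,y)=\min\{x,y\}$ applied componentwise, $$\Phi(z)=\begin{pmatrix}\mathbf{L}(z)\\ \phi(-g_1(a),\lambda_1)\\ \vdots\\ \phi(-g_N(a),\lambda_N)\end{pmatrix},$$ so that $\Phi(z)=0$ expresses the concatenated KKT conditions of all players. $\mathrm{Jac}\,\Phi(z)$ denotes the limiting Jacobian (B-subdifferential) of the locally Lipschitz function $\Phi$ at $z$: the set of all limits $\lim_{j}\Phi'(z_j)$ of Jacobian matrices along sequences $z_j\to z$ of points at which $\Phi$ is differentiable. At each iteration $J\Phi(z^k)$ is an arbitrary element of $\mathrm{Jac}\,\Phi(z^k)$. A point $z^*$ is quasi-regular if all matrices in $\mathrm{Jac}\,\Phi(z^* )$ are nonsingular. $\mathbf{B}(z^*,\delta)$ is the open Euclidean ball with center $z^*$ and radius $\delta$; $\|\cdot\|$ is the Euclidean norm. *)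

(* Defs.v *)
From HB Require Import structures.
From mathcomp Require Export all_boot all_order all_algebra.
From mathcomp Require Export all_classical all_reals all_analysis.
Export Order.TTheory GRing.Theory Num.Theory.
Export numFieldNormedType.Exports.

Set Implicit Arguments.
Unset Strict Implicit.
Unset Printing Implicit Defensive.

Local Open Scope classical_set_scope.
Local Open Scope ring_scope.

(* Vectors are row vectors, and matrices of derivatives follow the convention
   of [jacobian]: the derivative of f at p sends v to v *m jacobian f p, so
   that jacobian f p is the transpose of the usual Jacobian matrix. *)

(* The library norm `|v| on 'rV[R]_n is the sup norm. *)
Definition enorm (R : realType) (n : nat) (v : 'rV[R]_n) : R :=
  Num.sqrt (\sum_(i < n) v 0 i ^+ 2).

Definition grad (R : realType) (n : nat) (f : 'rV[R]_n -> R) (a : 'rV[R]_n)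
  : 'rV[R]_n := \row_(j < n) 'D_(delta_mx 0 j) f a.

Definition hessian (R : realType) (n : nat) (f : 'rV[R]_n -> R) (a : 'rV[R]_n)
  : 'M[R]_n := jacobian (grad f) a.

(* The Lipschitz constant refers to the sup norms of the library, which are
   equivalent to the Euclidean ones. *)
Definition C2_lip (R : realType) (n : nat) (f : 'rV[R]_n -> R) : Prop :=
  [/\ forall a, differentiable f a,
      forall a, differentiable (grad f) a,
      continuous (hessian f)
    & exists k : R, k.-lipschitz (hessian f)].

(* Limiting Jacobian (B-subdifferential). *)
Definition Jac (R : realType) (p q : nat) (F : 'rV[R]_p -> 'rV[R]_q)
    (z : 'rV[R]_p) : set 'M[R]_(p, q) :=
  [set H | exists u : nat -> 'rV[R]_p,
    [/\ u @ \oo --> z,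
        forall j, differentiable F (u j)
      & (fun j => jacobian F (u j)) @ \oo --> H]].

Definition quasi_regular (R : realType) (p : nat) (F : 'rV[R]_p -> 'rV[R]_p)
    (z : 'rV[R]_p) : Prop :=
  forall H, Jac F z H -> H \in unitmx.

(* [newton_eq F H r z w] is F(z) + H (w - z) = r, in row-vector form. *)
Definition newton_eq (R : realType) (p : nat) (F : 'rV[R]_p -> 'rV[R]_p)
    (H : 'M[R]_p) (r z w : 'rV[R]_p) : Prop :=
  F z + (w - z) *m H = r.

Definition newton_step (R : realType) (p : nat) (F : 'rV[R]_p -> 'rV[R]_p)
    (r z w : 'rV[R]_p) : Prop :=
  exists2 H, Jac F z H & newton_eq F H r z w.

(* The method started at z0 never breaks down: at every iterate reached by a
   finite run, a matrix in the limiting Jacobian is available, and each such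
   matrix makes the Newton equation uniquely solvable. *)
Definition newton_well_defined (R : realType) (p : nat)
    (F : 'rV[R]_p -> 'rV[R]_p) (r : nat -> 'rV[R]_p) (z0 : 'rV[R]_p) : Prop :=
  forall (k : nat) (z : nat -> 'rV[R]_p),
    z 0%N = z0 ->
    (forall j, (j < k)%N -> newton_step F (r j) (z j) (z j.+1)) ->
    Jac F (z k) !=set0 /\
    forall H, Jac F (z k) H -> exists! w, newton_eq F H (r k) (z k) w.

(* The variable a = (a_1, ..., a_N) is the row vector whose i-th block is
   submxrow a i, of size n_ i; similarly for l = (l_1, ..., l_N) with block
   sizes m_ i, and z = (a, l) is row_mx a l. *)

Definition lagrangian (R : realType) (N : nat) (n_ m_ : 'I_N -> nat)
    (J : 'I_N -> 'rV[R]_(\sum_i n_ i) -> R)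
    (g : forall i : 'I_N, 'rV[R]_(\sum_i n_ i) -> 'rV[R]_(m_ i))
    (i : 'I_N) (a : 'rV[R]_(\sum_i n_ i)) (li : 'rV[R]_(m_ i)) : R :=
  J i a + \sum_(j < m_ i) li 0 j * g i a 0 j.

Definition pseudo_gradient (R : realType) (N : nat) (n_ m_ : 'I_N -> nat)
    (J : 'I_N -> 'rV[R]_(\sum_i n_ i) -> R)
    (g : forall i : 'I_N, 'rV[R]_(\sum_i n_ i) -> 'rV[R]_(m_ i))
    (a : 'rV[R]_(\sum_i n_ i)) (l : 'rV[R]_(\sum_i m_ i))
  : 'rV[R]_(\sum_i n_ i) :=
  \mxrow_(i < N)
    submxrow (grad (fun a' => lagrangian J g a' (submxrow l i)) a) i.

Definition KKT (R : realType) (N : nat) (n_ m_ : 'I_N -> nat)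
    (J : 'I_N -> 'rV[R]_(\sum_i n_ i) -> R)
    (g : forall i : 'I_N, 'rV[R]_(\sum_i n_ i) -> 'rV[R]_(m_ i))
    (z : 'rV[R]_(\sum_i n_ i + \sum_i m_ i))
  : 'rV[R]_(\sum_i n_ i + \sum_i m_ i) :=
  let a := lsubmx z in
  let l := rsubmx z in
  row_mx (pseudo_gradient J g a l)
    (\mxrow_(i < N)
       \row_(j < m_ i) Num.min (- g i a 0 j) (submxrow l i 0 j)).

(* Main.v *)
From mathcomp Require Import ring lra.
Require Import Defs.

(** The KKT map is a componentwise minimum of pairs of C^1 functions with
    derivatives that are Lipschitz at the solution. Each component of the
    complementarity part compares -g_ij with its own multiplier, so moving the
    multipliers up or down makes any prescribed active choice of branches
    strictly active. Hence Jac Phi(z) consists exactly of the Jacobians of the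
    smooth maps selected by the active choices of branches; it is never empty,
    and it is described by finitely many continuous matrix functions.
    Near the solution z*, a choice active at z is also active at z*, so
    quasi-regularity bounds the inverses uniformly, and Phi agrees with the
    selected smooth map at both z and z*. Taylor's formula for that map gives
    the quadratic estimate of a Newton step, and the estimate keeps all the
    iterates in the initial ball. *)

Set Implicit Arguments.
Unset Strict Implicit.
Unset Printing Implicit Defensive.

Local Open Scope classical_set_scope.
Local Open Scope ring_scope.

(** * Functions with a calm derivative *)

Section Calm.
Context {R : realType} {V : normedModType R}.
Implicit Types (s : V) (f g : V -> R).

(** A Lipschitz estimate based at the single point [s]. Unlike a global Lipschitz condition it is
    stable under products, and it follows from differentiability at [s]. *)
Definition calm s f : Prop :=
  exists2 C : R, 0 <= C & \forall x \near s, `|f x - f s| <= C * `|x - s|.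

Lemma calm_cst s (c : R) : calm s (cst c).
Proof.
by exists 0 => //; apply: nearW => x; rewrite subrr normr0 mul0r.
Qed.

Lemma calmD s f g : calm s f -> calm s g -> calm s (f + g).
Proof.
move=> [C C0 Cf] [D D0 Dg]; exists (C + D); first exact: addr_ge0.
near=> x.
rewrite [(f + g) x]/(f x + g x) [(f + g) s]/(f s + g s) opprD addrACA mulrDl.
by rewrite (le_trans (ler_normD _ _))// lerD//; near: x.
Unshelve. all: by end_near. Qed.

Lemma calmM s f g : calm s f -> calm s g -> calm s (f * g).
Proof.
move=> [C C0 Cf] [D D0 Dg].
(* On the unit ball around [s], [|f x|] is at most [|f s| + C]; the rest is the splitting of the
   difference of products below. *)
exists ((`|f s| + C) * D + C * `|g s|).
  by rewrite addr_ge0// mulr_ge0// addr_ge0.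
near=> x.
have xs1 : `|x - s| <= 1.
  by rewrite distrC; near: x; apply: (@cvgr_dist_le _ _ _ _ _ id s (@cvg_id _ _)).
have fx : `|f x - f s| <= C * `|x - s| by near: x.
have gx : `|g x - g s| <= D * `|x - s| by near: x.
have fxb : `|f x| <= `|f s| + C.
  rewrite -[f x](subrK (f s)) addrC (le_trans (ler_normD _ _))// lerD2l.
  by rewrite (le_trans fx)// ler_piMr.
rewrite [(f * g) x]/(f x * g x) [(f * g) s]/(f s * g s).
have -> : f x * g x - f s * g s = f x * (g x - g s) + (f x - f s) * g s.
  by rewrite mulrBr mulrBl addrA subrK.
rewrite (le_trans (ler_normD _ _))// !normrM mulrDl -mulrA lerD//.
  by rewrite -mulrA ler_pM.
by rewrite [`|g s| * _]mulrC mulrA ler_wpM2r.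
Unshelve. all: by end_near. Qed.

(** The differential is bounded by some [k], and the little-o remainder, taken with factor 1, adds
    at most [|x - s|]; hence the constant [k + 1]. *)
Lemma differentiable_calm s f : differentiable f s -> calm s f.
Proof.
move=> fs; have [k k0 kd] := linear_lipschitz (diff_continuous fs).
exists (k + 1); first by rewrite addr_ge0// ltW.
have /eqaddoP/(_ 1 ltr01) := diff_locally fs.
rewrite near_simpl => fo.
near=> x.
have : `|f (x - s + s) - (f s + 'd f s (x - s))| <= 1 * `|x - s|.
  near: x.
  have : (fun x => x - s) @ s --> s - s by apply: cvgB => //; exact: cvg_cst.
  by rewrite subrr => cv; exact: (cv _ fo).
rewrite subrK mulrDl opprD addrA => le1.
rewrite -[f x - f s](subrK ('d f s (x - s))) addrC.
by rewrite (le_trans (ler_normD _ _))// lerD.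
Unshelve. all: by end_near. Qed.

End Calm.

Lemma calm_comp (R : realType) (V W : normedModType R) (h : {linear V -> W})
    (s : V) (f : W -> R) :
  continuous h -> calm (h s) f -> calm s (f \o h).
Proof.
move=> hc [C C0 Cf]; have [k k0 kh] := linear_lipschitz hc.
exists (C * k); first by rewrite mulr_ge0// ltW.
near=> x.
have : `|f (h x) - f (h s)| <= C * `|h x - h s| by near: x; exact: (hc s _ Cf).
move=> /le_trans; apply; rewrite -mulrA ler_wpM2l//.
by rewrite -linearB.
Unshelve. all: by end_near. Qed.

Section C1Calm.
Context {R : realType} {V : normedModType R}.
Implicit Types (s : V) (f g : V -> R).

(** Continuity is required everywhere, since limiting Jacobians are taken at points other than [s];
    calmness at [s] suffices because the Taylor estimate compares derivatives with those at [s]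
    only. *)
Definition C1_calm s f : Prop :=
  [/\ forall x, differentiable f x,
      forall v, continuous ('D_v f)
    & forall v, calm s ('D_v f)].

Lemma C1_calmD s f g : C1_calm s f -> C1_calm s g -> C1_calm s (f + g).
Proof.
move=> [df cf lf] [dg cg lg].
have D v : 'D_v (f + g) = 'D_v f + 'D_v g.
  by apply/funext => x; rewrite deriveD//; exact: diff_derivable.
split=> [x|v x|v]; first exact: differentiableD.
- by rewrite D; apply: cvgD; [exact: cf|exact: cg].
- by rewrite D; exact: calmD.
Qed.

Lemma C1_calmM s f g : C1_calm s f -> C1_calm s g -> C1_calm s (f * g).
Proof.
move=> [df cf lf] [dg cg lg].
have D v : 'D_v (f * g) = f * 'D_v g + g * 'D_v f.
  by apply/funext => x; rewrite deriveM//; exact: diff_derivable.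
split=> [x|v x|v]; first exact: differentiableM.
- rewrite D; apply: cvgD; apply: cvgM.
  + exact: differentiable_continuous.
  + exact: cg.
  + exact: differentiable_continuous.
  + exact: cf.
- by rewrite D; apply: calmD; apply: calmM => //; exact: differentiable_calm.
Qed.

Lemma C1_calm_cst s (c : R) : C1_calm s (cst c).
Proof.
have D v : 'D_v (cst c : V -> R) = cst 0.
  by apply/funext => x; rewrite derive_cst.
split=> [x|v x|v]; first exact: differentiable_cst.
- by rewrite D; exact: cvg_cst.
- by rewrite D; exact: calm_cst.
Qed.

Lemma C1_calmN s f : C1_calm s f -> C1_calm s (- f).
Proof.
move=> sf; have -> : - f = cst (-1) * f.
  by apply/funext => x; rewrite [RHS](_ : _ = -1 * f x)// mulN1r.
by apply: C1_calmM => //; exact: C1_calm_cst.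
Qed.

Lemma C1_calm_sum s (I : Type) (r : seq I) (F : I -> V -> R) :
  (forall i, C1_calm s (F i)) -> C1_calm s (\sum_(i <- r) F i).
Proof.
by move=> sF; elim/big_ind : _ => //; [exact: (C1_calm_cst _ 0)|exact: C1_calmD].
Qed.

End C1Calm.

Lemma derive_comp_linear (R : numFieldType) (V W U : normedModType R)
    (h : {linear V -> W}) (f : W -> U) (v x : V) :
  'D_v (f \o h) x = 'D_(h v) f (h x).
Proof.
rewrite /derive; set F := (fun t : R => _); set G := (fun t : R => _).
suff -> : F = G by [].
apply/funext => t; rewrite /F /G /=.
have E : h (t *: v + x) = t *: h v + h x by rewrite linearP.
by rewrite E.
Qed.

Lemma C1_calm_comp_linear (R : realType) (V W : normedModType R)
    (h : {linear V -> W}) (s : V) (f : W -> R) :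
  continuous h -> C1_calm (h s) f -> C1_calm s (f \o h).
Proof.
move=> hc [df cf lf].
have D v : 'D_v (f \o h) = 'D_(h v) f \o h.
  by apply/funext => x; rewrite derive_comp_linear.
split=> [x|v x|v].
- by apply: differentiable_comp => //; exact: linear_differentiable.
- by rewrite D; apply: continuous_comp; [exact: hc|exact: cf].
- by rewrite D; exact: calm_comp.
Qed.

Lemma C1_calm_coord (R : realType) p (s : 'rV[R]_p) (j : 'I_p) :
  C1_calm s (fun z => z 0 j).
Proof.
have D v : 'D_v (fun z : 'rV[R]_p => z 0 j) = cst (v 0 j).
  apply/funext => x.
  have := derive_mx (@derivable_id _ _ x v).
  by rewrite derive_id => /matrixP/(_ 0 j); rewrite mxE => ->.
split=> [x|v x|v]; first exact: differentiable_coord.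
- by rewrite D; exact: cst_continuous.
- by rewrite D; exact: calm_cst.
Qed.

(** * Sup norms, partial derivatives and a Taylor estimate on row vectors *)

Section RowVectors.
Context {R : realType}.

Lemma mx_entry_le m n (A : 'M[R]_(m, n)) i j : `|A i j| <= `|A|.
Proof.
by rewrite [leRHS]/Num.Def.normr/= mx_normrE; exact: (le_bigmax _ _ (i, j)).
Qed.

Lemma mx_norm_le m n (A : 'M[R]_(m, n)) c :
  0 <= c -> (forall i j, `|A i j| <= c) -> `|A| <= c.
Proof.
by move=> c0 Ac; rewrite [leLHS]/Num.Def.normr/= mx_normrE; apply: bigmax_le.
Qed.

Lemma mulmx_norm_le p q (v : 'rV[R]_p) (A : 'M[R]_(p, q)) :
  `|v *m A| <= p%:R * `|v| * `|A|.
Proof.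
apply: mx_norm_le => [|i j]; first by rewrite !mulr_ge0.
rewrite mxE (le_trans (ler_norm_sum _ _ _))//.
rewrite -mulrA mulr_natl -[in X in _ <= _ *+ X](card_ord p) -sumr_const.
by apply: ler_sum => k _; rewrite normrM ler_pM// mx_entry_le.
Qed.

Lemma cvg_mx (T : Type) (F : set_system T) (FF : Filter F) m n
    (f : T -> 'M[R]_(m, n)) (A : 'M[R]_(m, n)) :
  (forall i j, f x i j @[x --> F] --> A i j) -> f x @[x --> F] --> A.
Proof.
move=> fA; apply/cvgrPdist_le => e e0; near=> x.
apply: mx_norm_le => [|i j]; first exact: ltW.
move: i j; near: x; apply: filter_forall => i; apply: filter_forall => j.
by under eq_near do rewrite !mxE; move/cvgrPdist_le : (fA i j); apply.
Unshelve. all: by end_near. Qed.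

Lemma deriveE_partials p (f : 'rV[R]_p -> R) (x v : 'rV[R]_p) :
  differentiable f x ->
  'D_v f x = \sum_i v 0 i * 'D_(delta_mx 0 i) f x.
Proof.
move=> fx; rewrite deriveE// [v in LHS]row_sum_delta linear_sum.
by apply: eq_bigr => i _; rewrite deriveE// linearZ.
Qed.

Lemma C1_calm_partials p (s : 'rV[R]_p) (f : 'rV[R]_p -> R) :
  (forall x, differentiable f x) ->
  (forall i, continuous ('D_(delta_mx 0 i) f)) ->
  (forall i, calm s ('D_(delta_mx 0 i) f)) ->
  C1_calm s f.
Proof.
move=> df cf lf.
have D v : 'D_v f = \sum_i (cst (v 0 i) * 'D_(delta_mx 0 i) f).
  apply/funext => x; rewrite deriveE_partials// fct_sumE.
  by apply: eq_bigr.
split=> // v.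
- rewrite D; apply: (big_ind (fun g : 'rV[R]_p -> R => continuous g)).
  + exact: (@cst_continuous _ _ (0 : R)).
  + by move=> g h gc hc x; exact: (continuousD (gc x) (hc x)).
  + by move=> i _ x; apply: continuousM; [exact: cst_continuous|exact: cf].
- rewrite D; elim/big_ind : _ => //.
  + exact: (calm_cst _ 0).
  + by move=> g h; exact: calmD.
  + by move=> i _; apply: calmM => //; exact: calm_cst.
Qed.

Lemma C1_calm_C2_lip n (f : 'rV[R]_n -> R) (s : 'rV[R]_n) :
  C2_lip f -> C1_calm s f.
Proof.
case=> df dg _ _.
have dp i x : differentiable ('D_(delta_mx 0 i) f) x.
  have -> : 'D_(delta_mx 0 i) f = (fun v : 'rV[R]_n => v 0 i) \o grad f.
    by apply/funext => y; rewrite /= mxE.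
  by apply: differentiable_comp => //; exact: differentiable_coord.
apply: C1_calm_partials => // i.
- by move=> x; exact: differentiable_continuous.
- exact: differentiable_calm.
Qed.

(** The stationarity components contain first partials of the data; the partials of these are
    Hessian entries, which are continuous and Lipschitz by assumption. *)
Lemma C1_calm_partial_C2_lip n (f : 'rV[R]_n -> R) (s : 'rV[R]_n) (c : 'I_n) :
  C2_lip f -> C1_calm s ('D_(delta_mx 0 c) f).
Proof.
case=> df dg ch [k lh].
have E : 'D_(delta_mx 0 c) f = (fun v : 'rV[R]_n => v 0 c) \o grad f.
  by apply/funext => y; rewrite /= mxE.
have D i : 'D_(delta_mx 0 i) ('D_(delta_mx 0 c) f) = fun x => hessian f x i c.
  apply/funext => x.
  have := derive_mx (@diff_derivable _ _ _ _ _ (delta_mx 0 i) (dg x)).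
  rewrite deriveEjacobian// -rowE => /matrixP/(_ 0 c).
  by rewrite !mxE E => <-.
apply: C1_calm_partials => [x|i x|i].
- rewrite E.
  by apply: differentiable_comp => //; exact: differentiable_coord.
- rewrite D; apply: (@continuous_comp _ _ _ (hessian f) (fun A : 'M[R]_n => A i c)).
    exact: ch.
  exact: coord_continuous.
(* The Lipschitz constant [k] is not assumed nonnegative, whereas [calm] asks for a nonnegative
   one. *)
- rewrite D; exists `|k|; [exact: normr_ge0|near=> x].
  have := mx_entry_le (hessian f x - hessian f s) i c.
  have subE (A B : 'M[R]_n) : (A - B) i c = A i c - B i c by rewrite !mxE.
  rewrite subE => /le_trans; apply.
  apply: (le_trans (lh (x, s) (conj I I))).
  by rewrite ler_wpM2r// ler_norm.
Unshelve. all: by end_near. Qed.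

(** The expansion is at [z], where Newton's method takes its Jacobian, and is evaluated at [s]. The
    mean value theorem on the segment from [z] to [s] leaves a difference of derivatives at two
    points, each of which is compared with the derivative at [s]. *)
Lemma C1_calm_taylor p (s : 'rV[R]_p) (f : 'rV[R]_p -> R) : C1_calm s f ->
  exists2 C : R, 0 <= C &
    \forall z \near s, `|f s - f z - 'D_(s - z) f z| <= C * `|s - z| ^+ 2.
Proof.
move=> [df cf lf].
have {lf} [C C0 lC] : exists2 C : R, 0 <= C &
    \forall x \near s, forall i,
      `|'D_(delta_mx 0 i) f x - 'D_(delta_mx 0 i) f s| <= C * `|x - s|.
  have /choice[c cP] : forall i : 'I_p, exists c : R, 0 <= c /\
      \forall x \near s,
        `|'D_(delta_mx 0 i) f x - 'D_(delta_mx 0 i) f s| <= c * `|x - s|.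
    by move=> i; have [c c0 cP] := lf (delta_mx 0 i); exists c.
  exists (\sum_i c i); first by apply: sumr_ge0 => i _; case: (cP i).
  near=> x => i.
  apply: (@le_trans _ _ (c i * `|x - s|)).
    by move: i; near: x; apply: filter_forall => i; case: (cP i).
  rewrite ler_wpM2r// (bigD1 i)//= lerDl; apply: sumr_ge0 => j _.
  by case: (cP j).
have /nbhs_ballP[e /= e0 eP] := lC.
(* For each coordinate, one [C] for the intermediate point and one for [z]. *)
exists (\sum_(i < p) C *+ 2); first by apply: sumr_ge0 => i _; rewrite mulrn_wge0.
near=> z.
have ze : ball s e z by near: z; exact: nbhsx_ballx.
pose h (t : R) := z + t *: (s - z).
have hD (t : R) : is_derive t (1 : R) (f \o h) ('D_(s - z) f (h t)).
  have E : (fun k : R => k^-1 *: ((f \o h \o shift t) (k *: (1 : R)) - (f \o h) t))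
      = (fun k => k^-1 *: ((f \o shift (h t)) (k *: (s - z)) - f (h t))).
    apply/funext => k /=; congr (_ *: (f _ - _)).
    by rewrite /h [k *: 1]mulr1 scalerDl addrCA.
  by apply: DeriveDef; rewrite /derivable /derive E//; exact: diff_derivable.
have [t t01] : exists2 t : R, t \in `]0, 1[%R &
    (f \o h) 1 - (f \o h) 0 = 'D_(s - z) f (h t) * (1 - 0).
  apply: MVT => // x; apply: continuous_subspaceT => y.
  exact/differentiable_continuous/derivable1_diffP.
rewrite /h /= scale1r scale0r addr0 subrKC subr0 mulr1 -/(h t) => ->.
have hts : `|h t - s| <= `|s - z|.
  have -> : h t - s = (t - 1) *: (s - z).
    by rewrite /h scalerBl scale1r opprB addrCA addrA.
  rewrite normrZ ler_piMl//; move: t01; rewrite in_itv/= => /andP[t0 t1].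
  by rewrite distrC ger0_norm ?subr_ge0 ?(ltW t1)// lerBlDr lerDl ltW.
have hte : ball s e (h t).
  move: ze; rewrite -!ball_normE/= => ze.
  by rewrite distrC (le_lt_trans hts).
rewrite !deriveE_partials// -sumrB (le_trans (ler_norm_sum _ _ _))// mulr_suml.
apply: ler_sum => i _; rewrite -mulrBr normrM expr2 mulrA mulrC.
apply: ler_pM => //; last by rewrite mx_entry_le.
rewrite -(subrKA ('D_(delta_mx 0 i) f s)) (le_trans (ler_normD _ _))//.
rewrite mulr2n mulrDl lerD//.
  by rewrite (le_trans (eP _ hte i))// ler_wpM2l.
by rewrite distrC [`|s - z|]distrC; exact: eP.
Unshelve. all: by end_near. Qed.

End RowVectors.

(** * Derivatives and jacobians *)

Lemma near_lt_le (R : realType) (V : normedModType R) (f g : V -> R) (x : V) :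
  {for x, continuous f} -> {for x, continuous g} -> f x < g x ->
  \forall y \near x, f y <= g y.
Proof.
move=> cf cg fg; near=> y; rewrite -subr_ge0 ltW//; near: y.
have cv : (fun y => g y - f y) @ x --> g x - f x by exact: (cvgB cg cf).
have gt0 : 0 < g x - f x by rewrite subr_gt0.
exact: (@cvgr_gt _ _ _ _ _ _ cv _ gt0).
Unshelve. all: by end_near. Qed.

Lemma near_eq_differentiable (R : realType) (V W : normedModType R)
    (f g : V -> W) (x : V) :
  {near x, f =1 g} -> differentiable f x -> differentiable g x.
Proof.
move=> fg fx; have [dfc dfx] := (diff_locallyP _ _).1 fx.
have gx : g \o shift x = cst (g x) + 'd f x +o_ 0 id.
  apply/eqaddoP => e e0; have /eqaddoP/(_ e e0) := dfx.
  rewrite !near_simpl => fe; near=> h.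
  have fgx : f x = g x by exact: (nbhs_singleton fg).
  have fgh : f (h + x) = g (h + x).
    near: h.
    have : (fun h => h + x) @ 0 --> 0 + x by apply: cvgD => //; exact: cvg_cst.
    by rewrite add0r => cv; exact: (cv _ fg).
  have : `|f (h + x) - (f x + 'd f x h)| <= e * `|h| by near: h; exact: fe.
  by rewrite fgx fgh.
by apply/diff_locallyP; rewrite (diff_unique dfc gx).
Unshelve. all: by end_near. Qed.

Lemma derive_touching (R : realType) (V : normedModType R) (f g : V -> R)
    (x v : V) :
  (forall y, f y <= g y) -> f x = g x ->
  differentiable f x -> differentiable g x -> 'D_v f x = 'D_v g x.
Proof.
(* g - f has a minimum at x, so its directional derivatives are nonnegative. *)
move=> fg fgx df dg.
have dB w : derivable (g - f) x w.
  by apply: derivableB; exact: diff_derivable.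
have D w : 'D_w (g - f) x = 'd g x w - 'd f x w.
  by rewrite deriveB ?deriveE//; exact: diff_derivable.
have D0 w : 0 <= 'D_w (g - f) x.
  have cv : (fun h : R => h^-1 *: (((g - f) \o shift x) (h *: w) - (g - f) x))
      @ 0^'+ --> 'D_w (g - f) x.
    have cw : (fun h : R => h^-1 *: (((g - f) \o shift x) (h *: w) - (g - f) x))
        @ 0^' --> 'D_w (g - f) x by exact: dB w.
    apply: cvg_trans cw; apply: cvg_app.
    move=> P [e /= e0 eP]; exists e => //= h he h0.
    by apply: eP => //; rewrite gt_eqF.
  apply: (cvgr_to_ge cv); near=> h.
  have -> : (g - f) x = 0 by rewrite (_ : (g - f) x = g x - f x)// fgx subrr.
  rewrite subr0 mulr_ge0 ?invr_ge0//.
  rewrite (_ : _ (h *: w) = g (h *: w + x) - f (h *: w + x))//.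
  by rewrite subr_ge0.
rewrite !deriveE//; apply/eqP; rewrite eq_le -subr_ge0 -[X in _ && X]subr_ge0.
rewrite -D D0/=.
(* Nonnegativity in the direction [- v] is the reverse inequality. *)
by have := D0 (- v); rewrite D !linearN opprK addrC.
Unshelve. all: by end_near. Qed.

(** Replaces the extraction of a subsequence: with distinct limits, the difference [u - v] would
    eventually be nonzero. *)
Lemma frequently_eq_lim (R : realType) (u v : nat -> R) (x y : R) :
  u @ \oo --> x -> v @ \oo --> y ->
  (forall K, exists2 k, (K <= k)%N & u k = v k) -> x = y.
Proof.
move=> ux vy uv; apply/eqP; rewrite -subr_eq0; apply/negPn/negP => xy.
have [K _ KP] := cvgr_neq0 _ (cvgB ux vy) xy.
have [k Kk ukvk] := uv K.
have := KP k Kk.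
by rewrite (_ : _ k = u k - v k)// ukvk subrr eqxx.
Qed.

Section Jacobian.
Context {R : realType}.

Lemma jacobianE p q (F : 'rV[R]_p -> 'rV[R]_q) z i j : differentiable F z ->
  jacobian F z i j = 'D_(delta_mx 0 i) (fun x => F x 0 j) z.
Proof.
move=> Fz; have := derive_mx (@diff_derivable _ _ _ _ _ (delta_mx 0 i) Fz).
rewrite deriveEjacobian// -rowE => /matrixP/(_ 0 j).
have rowE' (A : 'M[R]_(p, q)) : row i A 0 j = A i j by rewrite mxE.
by rewrite rowE' => ->; rewrite mxE.
Qed.

Lemma differentiable_rV p q (F : 'rV[R]_p -> 'rV[R]_q) z :
  (forall j, differentiable (fun x => F x 0 j) z) -> differentiable F z.
Proof.
move=> dF.
have -> : F = \sum_j (fun x => F x 0 j *: delta_mx 0 j).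
  by apply/funext => x; rewrite [LHS]row_sum_delta fct_sumE.
by apply: differentiable_sum => j; exact: differentiableZl.
Qed.

End Jacobian.

(** * Componentwise minima and their limiting Jacobians *)

Section MinMap.
Context {R : realType} {p : nat}.
Implicit Types (S : bool -> 'I_p -> 'rV[R]_p -> R) (z s : 'rV[R]_p).

Definition minmap S z : 'rV[R]_p :=
  \row_j Num.min (S true j z) (S false j z).

(** The inequality is not strict, so at a tie both branches are active. Choices form a finite type,
    so that constants can be summed and neighbourhoods intersected over them. *)
Definition active S z (c : {ffun 'I_p -> bool}) : Prop :=
  forall j, S (c j) j z <= S (~~ c j) j z.

(** The Jacobian, in the row-vector convention, of the smooth map whose component [j] is
    [S (c j) j]. *)
Definition selection_jac S (c : {ffun 'I_p -> bool}) z : 'M[R]_p :=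
  \matrix_(i, j) 'D_(delta_mx 0 i) (S (c j) j) z.

(* Perturbing z along e produces differentiability points of [minmap S]
   at which c is the active choice. *)
Definition branch_separable S : Prop :=
  forall z c, active S z c ->
    exists e : 'rV[R]_p, forall t : R, 0 < t -> forall j,
      \forall y \near z + t *: e, S (c j) j y <= S (~~ c j) j y.

Lemma minmap_le S b j z : minmap S z 0 j <= S b j z.
Proof. by rewrite mxE ge_min; case: b; rewrite lexx ?orbT. Qed.

Lemma minmapE S b j z : S b j z <= S (~~ b) j z -> minmap S z 0 j = S b j z.
Proof. by rewrite mxE; case: b => /= ?; [rewrite min_l|rewrite min_r]. Qed.

Lemma active_exists S z : exists c, active S z c.
Proof.
exists [ffun j => S true j z <= S false j z] => j; rewrite ffunE.
by case: (leP (S true j z) (S false j z)) => //= /ltW.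
Qed.

Lemma minmapE_inv S b j z : minmap S z 0 j = S b j z -> S b j z <= S (~~ b) j z.
Proof. by move<-; exact: minmap_le. Qed.

Section SmoothBranches.
Context {S : bool -> 'I_p -> 'rV[R]_p -> R} {s : 'rV[R]_p}.
Context (S_smooth : forall b j, C1_calm s (S b j)).

Let dS b j z : differentiable (S b j) z.
Proof. by case: (S_smooth b j). Qed.

Let cS b j z : {for z, continuous (S b j)}.
Proof. exact: differentiable_continuous. Qed.

Lemma continuous_minmap j : continuous (fun z => minmap S z 0 j).
Proof.
move=> z; rewrite (_ : (fun z => _) = S true j \min S false j); last first.
  by apply/funext => x; rewrite mxE.
exact: continuous_min.
Qed.

Lemma continuous_selection_jac c : continuous (selection_jac S c).
Proof.
move=> z; apply: (@cvg_mx _ _ (nbhs z)) => i j; rewrite /selection_jac mxE.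
under eq_fun do rewrite mxE.
by case: (S_smooth (c j) j) => _ + _; apply.
Qed.

(** An active branch lies above the minimum and touches it at [z]. Ties are harmless: where the
    minimum is differentiable, all active branches have its derivative. *)
Lemma derive_minmap b j z v : S b j z <= S (~~ b) j z ->
  differentiable (minmap S) z ->
  'D_v (fun x => minmap S x 0 j) z = 'D_v (S b j) z.
Proof.
move=> Sb dF; apply: derive_touching => //; first by move=> y; exact: minmap_le.
- exact: minmapE.
- apply: (@differentiable_comp _ _ _ _ (minmap S) (fun v => v 0 j)) => //.
  exact: differentiable_coord.
Qed.

Lemma jacobian_minmap c z : active S z c -> differentiable (minmap S) z ->
  jacobian (minmap S) z = selection_jac S c z.
Proof.
move=> ac dF; apply/matrixP => i j.
by rewrite jacobianE// (derive_minmap _ (ac j))// mxE.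
Qed.

(** Along the separating direction [e] the choice [c] is active on a whole neighbourhood of each
    perturbed point. There the minimum coincides with a smooth map, and continuity of its Jacobian
    gives the limit at [z]. *)
Lemma Jac_selection c z : branch_separable S -> active S z c ->
  Jac (minmap S) z (selection_jac S c z).
Proof.
move=> sepS ac; have [e eP] := sepS _ _ ac.
pose u (k : nat) := z + (k.+1%:R^-1 : R) *: e.
have uz : u @ \oo --> z.
  rewrite -[z in _ --> z]addr0 -(scale0r e); apply: cvgD; first exact: cvg_cst.
  by apply: cvgZr_tmp; exact: cvg_harmonic.
have near_act k : \forall y \near u k, active S y c.
  by apply: (@filter_forall _ _ _ (nbhs (u k))) => j; apply: eP.
have dF k : differentiable (minmap S) (u k).
  apply: differentiable_rV => j.
  apply: near_eq_differentiable (dS (c j) j (u k)).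
  near=> y; apply/esym/minmapE.
  by have : active S y c by near: y; exact: near_act.
exists u; split => //.
have -> : (fun k => jacobian (minmap S) (u k)) = selection_jac S c \o u.
  apply/funext => k /=; apply: jacobian_minmap => //.
  exact: nbhs_singleton (near_act k).
by apply: cvg_comp uz _; exact: continuous_selection_jac.
Unshelve. all: by end_near. Qed.

(** Each component has a branch that is active infinitely often along the sequence. Passing to the
    limit along those indices shows that it is active at [z] and identifies column [j] of [H].
    Components are treated separately, without a common subsequence. *)
Lemma Jac_minmapP z H : Jac (minmap S) z H ->
  exists2 c, active S z c & H = selection_jac S c z.
Proof.
move=> [u [uz dF JH]].
have /choice[c cP] : forall j, exists b, minmap S z 0 j = S b j z /\
    forall i, H i j = 'D_(delta_mx 0 i) (S b j) z.
  move=> j.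
  have [b bP] : exists b, forall K, exists2 k, (K <= k)%N &
      S b j (u k) <= S (~~ b) j (u k).
    (* Either the branch [true] is eventually always active, or [false] is active infinitely
       often. *)
    have [[K KP]|freq] := pselect (exists K, forall k, (K <= k)%N ->
      S true j (u k) <= S false j (u k)).
      exists true => K'; exists (maxn K K'); first exact: leq_maxr.
      by apply: KP; exact: leq_maxl.
    exists false => K; apply: contrapT => nk; apply: freq; exists K => k Kk.
    rewrite leNgt; apply/negP => /ltW lek; apply: nk; exists k => //.
  exists b; split.
    apply: (@frequently_eq_lim R (fun k => minmap S (u k) 0 j)
      (fun k => S b j (u k))).
    - exact: (continuous_cvg _ (@continuous_minmap j z) uz).
    - exact: (continuous_cvg _ (@cS b j z) uz).
    - by move=> K; have [k Kk /minmapE] := bP K; exists k.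
  move=> i.
  apply: (@frequently_eq_lim R (fun k => jacobian (minmap S) (u k) i j)
      (fun k => 'D_(delta_mx 0 i) (S b j) (u k))).
  - exact: (continuous_cvg _ (@coord_continuous _ _ _ i j H) JH).
  - have [_ /(_ (delta_mx 0 i) z) cD _] := S_smooth b j.
    exact: (continuous_cvg _ cD uz).
  - move=> K; have [k Kk bk] := bP K; exists k => //.
    by rewrite jacobianE// (derive_minmap _ bk).
exists [ffun j => c j].
  move=> j; rewrite ffunE; apply: minmapE_inv; exact: (cP j).1.
by apply/matrixP => i j; rewrite mxE ffunE; exact: (cP j).2.
Qed.

(** A branch that is strictly larger at [s] stays strictly larger nearby, by continuity. *)
Lemma near_active : \forall z \near s, forall c, active S z c -> active S s c.
Proof.
have : \forall z \near s, forall j b,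
    S b j z <= S (~~ b) j z -> S b j s <= S (~~ b) j s.
  apply: (@filter_forall _ _ _ (nbhs s)) => j.
  apply: (@filter_forall _ _ _ (nbhs s)) => b.
  have [le_s|lt_s] := leP (S b j s) (S (~~ b) j s).
    by near=> z.
  near=> z => le_z; exfalso; move: le_z; apply/negP; rewrite -ltNge -subr_gt0.
  near: z.
  have cv : (fun x => S b j x - S (~~ b) j x) @ s --> S b j s - S (~~ b) j s.
    exact: (cvgB (@cS b j s) (@cS (~~ b) j s)).
  have gt0 : 0 < S b j s - S (~~ b) j s by rewrite subr_gt0.
  exact: (@cvgr_gt _ _ _ _ _ _ cv _ gt0).
by apply: filterS => z zP c cz j; apply: zP.
Unshelve. all: by end_near. Qed.

(** Summing the Taylor constants over the finitely many branches makes the estimate uniform in [c],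
    active or not. *)
Lemma near_taylor : exists2 C : R, 0 <= C & \forall z \near s,
  forall c : {ffun 'I_p -> bool},
    `|\row_j (S (c j) j s - S (c j) j z) - (s - z) *m selection_jac S c z|
      <= C * `|s - z| ^+ 2.
Proof.
have /choice[C CP] : forall bj : bool * 'I_p, exists C : R, 0 <= C /\
    \forall z \near s, `|S bj.1 bj.2 s - S bj.1 bj.2 z
      - 'D_(s - z) (S bj.1 bj.2) z| <= C * `|s - z| ^+ 2.
  by move=> bj; have [C C0 CP] := C1_calm_taylor (S_smooth bj.1 bj.2); exists C.
have sC0 : 0 <= \sum_bj C bj by apply: sumr_ge0 => bj _; case: (CP bj).
exists (\sum_bj C bj) => //; near=> z => c.
apply: mx_norm_le => [|i j]; first by rewrite mulr_ge0// exprn_ge0.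
have -> : (\row_j (S (c j) j s - S (c j) j z) - (s - z) *m selection_jac S c z) i j
    = S (c j) j s - S (c j) j z - 'D_(s - z) (S (c j) j) z.
  rewrite mxE mxE [X in _ + X]mxE mxE deriveE_partials//; congr (_ - _).
  by apply: eq_bigr => k _; rewrite [X in _ * X]mxE ord1.
apply: (@le_trans _ _ (C (c j, j) * `|s - z| ^+ 2)).
  have : forall bj : bool * 'I_p, `|S bj.1 bj.2 s - S bj.1 bj.2 z
      - 'D_(s - z) (S bj.1 bj.2) z| <= C bj * `|s - z| ^+ 2.
    by near: z; apply: (@filter_forall _ _ _ (nbhs s)) => bj; case: (CP bj).
  by move=> /(_ (c j, j)).
rewrite ler_wpM2r ?exprn_ge0// (bigD1 (c j, j))//= lerDl.
by apply: sumr_ge0 => bj _; case: (CP bj).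
Unshelve. all: by end_near. Qed.

End SmoothBranches.
End MinMap.

(** * Perturbed Newton steps *)

Section Newton.
Context {R : realType} {p : nat}.

(** With [c] bounding the action of the inverse of [A], [|v|] is at most [c * |v H|] plus
    [c * p * |A - H| * |v|]; for [H] close to [A] the last term is at most half of [|v|] and is
    absorbed. The bound yields both injectivity of [H] and a uniform estimate for its inverse. *)
Lemma unitmx_near_lower_bound (A : 'M[R]_p) : A \in unitmx ->
  exists2 M : R, 0 <= M &
    \forall H \near A, forall v : 'rV[R]_p, `|v| <= M * `|v *m H|.
Proof.
move=> Au; pose c : R := p%:R * `|invmx A|.
have c0 : 0 <= c by rewrite mulr_ge0.
exists (2 * c); first by rewrite mulr_ge0.
(* The added 1 keeps the denominator of the radius positive even when [c * p] vanishes. *)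
have cp0 : 0 < 2 * (c * p%:R + 1) :> R.
  by rewrite mulr_gt0// ltr_wpDl// mulr_ge0.
near=> H => v.
have HA : `|A - H| <= (2 * (c * p%:R + 1))^-1.
  near: H.
  have i0 : 0 < (2 * (c * p%:R + 1))^-1 by rewrite invr_gt0.
  exact: (@cvgr_dist_le _ _ _ (nbhs A) _ id A (@cvg_id _ _) _ i0).
have le1 : `|v| <= c * `|v *m A|.
  have := mulmx_norm_le (v *m A) (invmx A).
  by rewrite mulmxK// => /le_trans; apply; rewrite mulrAC.
have le2 : `|v *m A| <= `|v *m H| + p%:R * `|v| * `|A - H|.
  rewrite -[X in v *m X](subrK H) mulmxDr addrC.
  by rewrite (le_trans (ler_normD _ _))// lerD2l mulmx_norm_le.
have le3 : c * p%:R * `|A - H| <= 2^-1.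
  apply: (@le_trans _ _ ((c * p%:R + 1) * (2 * (c * p%:R + 1))^-1)).
    by apply: ler_pM => //; [exact: mulr_ge0|rewrite lerDl].
  rewrite invfM mulrCA divff ?mulr1//.
  by rewrite gt_eqF// ltr_wpDl// mulr_ge0.
have le4 : c * p%:R * `|A - H| * `|v| <= 2^-1 * `|v| by rewrite ler_wpM2r.
have le5 := ler_wpM2l c0 le2.
have E : c * (p%:R * `|v| * `|A - H|) = c * p%:R * `|A - H| * `|v|.
  by rewrite !mulrA mulrAC.
rewrite mulrDr E in le5.
by lra.
Unshelve. all: by end_near. Qed.

(** The Newton equation turns [(w - s) H] into [r] plus the Taylor remainder of the selected smooth
    map, and the uniform lower bound on [|v H|] then controls [w - s]. *)
Lemma newton_local_estimate (S : bool -> 'I_p -> 'rV[R]_p -> R)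
    (s : 'rV[R]_p) :
  (forall b j, C1_calm s (S b j)) -> branch_separable S ->
  minmap S s = 0 -> quasi_regular (minmap S) s ->
  exists2 K : R, 0 <= K & \forall z \near s,
    Jac (minmap S) z !=set0 /\
    forall H, Jac (minmap S) z H -> H \in unitmx /\
      forall r w, newton_eq (minmap S) H r z w ->
        `|w - s| <= K * (`|z - s| ^+ 2 + `|r|).
Proof.
move=> smS sepS Ss0 qreg.
have [C C0 CP] := near_taylor smS.
have /choice[M MP] : forall c : {ffun 'I_p -> bool}, exists M : R, 0 <= M /\
    \forall z \near s, active S s c ->
      forall v : 'rV[R]_p, `|v| <= M * `|v *m selection_jac S c z|.
  move=> c; have [ac|nac] := pselect (active S s c); last first.
    (* For a choice inactive at [s] the requirement is vacuous. *)
    by exists 0; split=> //; near=> z.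
  have [M M0 MP] := unitmx_near_lower_bound (qreg _ (Jac_selection smS sepS ac)).
  exists M; split=> //.
  have cM : \forall z \near s,
      forall v : 'rV[R]_p, `|v| <= M * `|v *m selection_jac S c z|.
    exact: (@continuous_selection_jac _ _ _ _ smS c s _ MP).
  by near=> z => _; near: z.
have sM0 : 0 <= \sum_(c : {ffun 'I_p -> bool}) M c.
  by apply: sumr_ge0 => c _; case: (MP c).
exists ((\sum_(c : {ffun 'I_p -> bool}) M c) * (C + 1)).
  by rewrite mulr_ge0// addr_ge0.
near=> z.
have zC : forall c : {ffun 'I_p -> bool}, `|\row_j (S (c j) j s - S (c j) j z)
    - (s - z) *m selection_jac S c z| <= C * `|s - z| ^+ 2 by near: z.
have zM : forall c, active S s c ->
    forall v : 'rV[R]_p,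
      `|v| <= (\sum_(c : {ffun 'I_p -> bool}) M c) * `|v *m selection_jac S c z|.
  have : forall c, active S s c ->
    forall v : 'rV[R]_p, `|v| <= M c * `|v *m selection_jac S c z|.
    by near: z; apply: (@filter_forall _ _ _ (nbhs s)) => c; case: (MP c).
  move=> zM c ac v; rewrite (le_trans (zM c ac v))// ler_wpM2r//.
  by rewrite (bigD1 c)//= lerDl; apply: sumr_ge0 => d _; case: (MP d).
have zs : forall c, active S z c -> active S s c.
  by near: z; exact: (near_active smS).
split.
  by have [c ac] := active_exists S z; eexists; exact: (Jac_selection smS sepS ac).
move=> H /(Jac_minmapP smS)[c az ->{H}].
have as_ := zs c az.
split.
  rewrite -row_free_unit; apply: inj_row_free => v vH0.
  apply/eqP; rewrite -normr_le0 (le_trans (zM c as_ v))//.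
  by rewrite vH0 normr0 mulr0.
move=> r w; rewrite /newton_eq => eqr.
rewrite (le_trans (zM c as_ _))// -mulrA ler_wpM2l//.
have -> : (w - s) *m selection_jac S c z = r +
    (\row_j (S (c j) j s - S (c j) j z) - (s - z) *m selection_jac S c z).
  (* The choice [c] is active at both points, so the selected branches attain both minima. *)
  have -> : \row_j (S (c j) j s - S (c j) j z) = minmap S s - minmap S z.
    apply/rowP => j; rewrite [RHS]mxE [X in _ + X]mxE.
    by rewrite (minmapE (as_ j)) (minmapE (az j)) mxE.
  rewrite -eqr Ss0 sub0r addrACA subrr add0r -mulmxBl.
  by rewrite opprB addrA subrK.
rewrite (le_trans (ler_normD _ _))//.
rewrite mulrDl mul1r addrC.
apply: (@le_trans _ _ (C * `|s - z| ^+ 2 + `|r|)).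
  by rewrite lerD2r.
rewrite distrC mulrDr -!addrA lerD2l.
have := normr_ge0 r; have : 0 <= `|z - s| ^+ 2 by rewrite exprn_ge0.
have : 0 <= C * `|r| by rewrite mulr_ge0.
lra.
Unshelve. all: by end_near. Qed.

(** * Comparison of the Euclidean and sup norms, and invariance of a ball under Newton steps *)

Lemma enorm_ge0 (v : 'rV[R]_p) : 0 <= enorm v.
Proof. exact: sqrtr_ge0. Qed.

Lemma mx_norm_le_enorm (v : 'rV[R]_p) : `|v| <= enorm v.
Proof.
apply: mx_norm_le => [|i j]; first exact: enorm_ge0.
rewrite ord1 -sqrtr_sqr ler_wsqrtr// (bigD1 j)//= lerDl.
by apply: sumr_ge0 => k _; exact: sqr_ge0.
Qed.

Lemma enorm_le_mx_norm (v : 'rV[R]_p) : enorm v <= p%:R * `|v|.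
Proof.
have -> : p%:R * `|v| = Num.sqrt ((p%:R * `|v|) ^+ 2).
  by rewrite sqrtr_sqr ger0_norm// mulr_ge0.
rewrite ler_wsqrtr//.
apply: (@le_trans _ _ (\sum_(i < p) `|v| ^+ 2)).
  apply: ler_sum => i _; rewrite -[leLHS]real_normK ?num_real//.
  by rewrite lerXn2r ?nnegrE// mx_entry_le.
rewrite sumr_const card_ord -[leLHS]mulr_natl exprMn ler_wpM2r ?exprn_ge0//.
(* The coarse factor [p] in place of its square root costs only [p <= p ^ 2]. *)
by rewrite -natrX ler_nat; case: (p) => // n; rewrite expnS expn1 leq_pmulr.
Qed.

(** The radii are chosen so that the quadratic term and the disturbance term each contribute at most
    half of [dz]; the ball of radius [dz] is then invariant, and the one-step estimate applies at
    every iterate. *)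
Lemma newton_convergence (F : 'rV[R]_p -> 'rV[R]_p)
    (s : 'rV[R]_p) (K : R) : 0 <= K ->
  (\forall z \near s, Jac F z !=set0 /\
    forall H, Jac F z H -> H \in unitmx /\
      forall r w, newton_eq F H r z w ->
        `|w - s| <= K * (`|z - s| ^+ 2 + `|r|)) ->
  exists dz dr Lz Lr : R, [/\ 0 < dz, 0 < dr &
    forall (z0 : 'rV[R]_p) (r : nat -> 'rV[R]_p),
      enorm (z0 - s) < dz -> (forall k, enorm (r k) < dr) ->
      newton_well_defined F r z0 /\
      forall z : nat -> 'rV[R]_p,
        z 0%N = z0 ->
        (forall k, newton_step F (r k) (z k) (z k.+1)) ->
        forall k,
          enorm (z k.+1 - s)
            <= Lz * enorm (z k - s) ^+ 2 + Lr * enorm (r k)].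
Proof.
move=> K0 /nbhs_ballP[e /= e0 eP].
(* The factor [p] converts the sup norm estimate to the Euclidean norm; the added 1 makes [L]
   invertible. *)
pose L : R := p%:R * K + 1.
have L0 : 0 < L by rewrite ltr_wpDl// mulr_ge0.
pose dz := Num.min e (2 * L)^-1.
have dz0 : 0 < dz by rewrite lt_min e0 invr_gt0 mulr_gt0.
have LdzE : L * dz <= 2^-1.
  apply: (@le_trans _ _ (L * (2 * L)^-1)).
    by rewrite ler_pM2l// ge_min lexx orbT.
  by rewrite invfM mulrCA divff ?mulr1// gt_eqF.
(* Chosen so that [L * dr] is half of [dz]. *)
pose dr := dz / (2 * L).
have dr0 : 0 < dr by rewrite divr_gt0// mulr_gt0.
have in_ball z : enorm (z - s) < dz -> ball s e z.
  move=> zdz; rewrite -ball_normE/= distrC (le_lt_trans (mx_norm_le_enorm _))//.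
  by rewrite (lt_le_trans zdz)// ge_min lexx.
have step r z w : enorm (z - s) < dz -> newton_step F r z w ->
    enorm (w - s) <= L * enorm (z - s) ^+ 2 + L * enorm r.
  move=> /in_ball/eP[_ zH] [H /zH[_ HP] /HP ws].
  rewrite (le_trans (enorm_le_mx_norm _))// -mulrDr.
  apply: (@le_trans _ _ (p%:R * K * (enorm (z - s) ^+ 2 + enorm r))).
    rewrite -mulrA ler_wpM2l// (le_trans ws)// ler_wpM2l// lerD ?mx_norm_le_enorm//.
    by rewrite lerXn2r ?nnegrE ?enorm_ge0 ?mx_norm_le_enorm.
  by rewrite ler_wpM2r ?addr_ge0 ?exprn_ge0 ?enorm_ge0// lerDl.
have stay r z w : enorm (z - s) < dz -> enorm r < dr -> newton_step F r z w ->
    enorm (w - s) < dz.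
  move=> zdz rdr zw; rewrite (le_lt_trans (step _ _ _ zdz zw))//.
  have h1 : L * enorm (z - s) ^+ 2 <= 2^-1 * dz.
    rewrite expr2 mulrA; apply: ler_pM; rewrite ?mulr_ge0 ?enorm_ge0 ?(ltW L0)//.
      by rewrite (le_trans _ LdzE)// ler_pM2l// ltW.
    exact: ltW.
  have h2 : L * enorm r < 2^-1 * dz.
    have -> : 2^-1 * dz = L * dr.
      by rewrite /dr; field; rewrite gt_eqF.
    by rewrite ltr_pM2l.
  lra.
exists dz, dr, L, L; split=> // z0 r z0dz rdr.
(* Stated for finite runs, so that it serves both well-definedness and the estimate along infinite
   sequences. *)
have run k (z : nat -> 'rV[R]_p) : z 0%N = z0 ->
    (forall j, (j < k)%N -> newton_step F (r j) (z j) (z j.+1)) ->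
    enorm (z k - s) < dz.
  move=> zz0; elim: k => [|k IHk] zk; first by rewrite zz0.
  apply: stay (rdr k) (zk k (ltnSn k)); apply: IHk => j jk.
  by apply: zk; exact: ltnW.
split=> [k z zz0 zk|z zz0 zk k]; last first.
  by apply: step (zk k); apply: run => // j _; exact: zk.
have [J0 JP] := eP _ (in_ball _ (run _ _ zz0 zk)).
split=> // H /JP[Hu _]; exists (z k + (r k - F (z k)) *m invmx H).
split=> [|w]; rewrite /newton_eq.
  by rewrite addrAC subrr add0r mulmxKV// subrKC.
by move=> <-; rewrite [F _ + _]addrC addrK mulmxK// subrKC.
Qed.

End Newton.

(** * The KKT map *)

Section KKT.
Context {R : realType} {N : nat} {n_ m_ : 'I_N -> nat}.
Context (J : 'I_N -> 'rV[R]_(\sum_i n_ i) -> R).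
Context (g : forall i : 'I_N, 'rV[R]_(\sum_i n_ i) -> 'rV[R]_(m_ i)).
Local Notation n := (\sum_i n_ i)%N.
Local Notation m := (\sum_i m_ i)%N.

(** The derivative of the Lagrangian of the player owning coordinate [c], with its multipliers read
    off [z]. It is written with sums and products of functions of [z] so that the closure properties
    of [C1_calm] apply. *)
Definition stationarity (c : 'I_n) : 'rV[R]_(n + m) -> R :=
  let i := tagnat.sig1 c in
  'D_(delta_mx 0 c) (J i) \o lsubmx +
  \sum_(k < m_ i) (fun z : 'rV[R]_(n + m) => z 0 (rshift n (tagnat.Rank i k))) *
    ('D_(delta_mx 0 c) (fun a => g i a 0 k) \o lsubmx).

(* The two branches coincide on the stationarity components. *)
Definition KKT_selection (b : bool) (j : 'I_(n + m)) : 'rV[R]_(n + m) -> R :=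
  match fintype.split j with
  | inl c => stationarity c
  | inr d => if b
      then - ((fun a => g (tagnat.sig1 d) a 0 (tagnat.sig2 d)) \o lsubmx)
      else fun z => z 0 (rshift n d)
  end.

Context (J_smooth : forall i, C2_lip (J i)).
Context (g_smooth : forall i (j : 'I_(m_ i)), C2_lip (fun a => g i a 0 j)).
Arguments g_smooth : clear implicits.

(** On stationarity components the minimum of equal branches is trivial, and the Lagrangian is
    differentiated in [a] with the multipliers constant. *)
Lemma KKT_minmap : KKT J g = minmap KKT_selection.
Proof.
apply/funext => z; apply/rowP => j.
rewrite /KKT /minmap mxE [RHS]mxE /KKT_selection.
case: (fintype.split j) => [c|d]; last first.
  rewrite !mxE; congr (Num.min _ _).
  by rewrite tagnat.sig2K.
rewrite minxx !mxE tagnat.sig2K /stationarity.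
set i := tagnat.sig1 c.
rewrite (_ : (fun _ => _) = J i +
    \sum_(k < m_ i) (submxrow (rsubmx z) i 0 k \*o (fun a => g i a 0 k))); last first.
  apply/funext => a; rewrite /lagrangian [RHS](_ : _ = J i a +
    (\sum_(k < m_ i) (submxrow (rsubmx z) i 0 k \*o (fun a => g i a 0 k))) a)//.
  by rewrite fct_sumE.
have dJ : differentiable (J i) (lsubmx z) by case: (J_smooth i).
have dg k : derivable (fun a => g i a 0 k) (lsubmx z) (delta_mx 0 c).
  by apply: diff_derivable; case: (g_smooth i k).
have dmg k : derivable (submxrow (rsubmx z) i 0 k \*o (fun a => g i a 0 k))
    (lsubmx z) (delta_mx 0 c).
  exact: (derivableM (derivable_cst _ _ _) (dg k)).
rewrite deriveD; [|exact: diff_derivable|exact: derivable_sum].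
rewrite derive_sum//.
rewrite [RHS](_ : _ = 'D_(delta_mx 0 c) (J i) (lsubmx z) +
  (\sum_(k < m_ i) (fun z : 'rV[R]_(n + m) => z 0 (rshift n (tagnat.Rank i k))) *
    ('D_(delta_mx 0 c) (fun a => g i a 0 k) \o lsubmx)) z)//.
rewrite fct_sumE; congr (_ + _); apply: eq_bigr => k _.
rewrite deriveMl//.
by rewrite !mxE.
Qed.

Lemma KKT_selection_C1_calm s b j : C1_calm s (KKT_selection b j).
Proof.
rewrite /KKT_selection.
have sl (f : 'rV[R]_n -> R) : C1_calm (lsubmx s) f -> C1_calm s (f \o lsubmx).
  by apply: C1_calm_comp_linear; exact: continuous_lsubmx.
case: (fintype.split j) => [c|d].
  apply: C1_calmD.
    by apply: sl; exact: C1_calm_partial_C2_lip.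
  apply: C1_calm_sum => k; apply: C1_calmM; first exact: C1_calm_coord.
  by apply: sl; exact: C1_calm_partial_C2_lip (g_smooth _ _).
case: b; last exact: C1_calm_coord.
by apply: C1_calmN; apply: sl; exact: C1_calm_C2_lip (g_smooth _ _).
Qed.

(* Raising or lowering each multiplier makes the chosen branch of the
   minimum strictly active. *)
Lemma KKT_selection_branch_separable : branch_separable KKT_selection.
Proof.
move=> z c ac.
exists (row_mx 0 (\row_d (if c (rshift n d) then 1 else -1))) => t t0 j.
have cS b : {for z + t *: row_mx 0 (\row_d (if c (rshift n d) then 1 else -1)),
    continuous (KKT_selection b j)}.
  apply: differentiable_continuous.
  (* Only differentiability is extracted, so the base point 0 is arbitrary. *)
  by have [] := KKT_selection_C1_calm 0 b j.
have := ac j; move: cS; rewrite /KKT_selection.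
case: (split_ordP j) => [k _|d ->] cS; first by move=> _; near=> y.
set y0 := z + _ in cS *.
(* The perturbation moves the multipliers alone, so the constraint values do not change. *)
have y0T : lsubmx y0 = lsubmx z.
  by rewrite /y0 linearD linearZ/= row_mxKl scaler0 addr0.
have y0F : y0 0 (rshift n d) = z 0 (rshift n d) +
    t * (if c (rshift n d) then 1 else -1).
  by rewrite mxE [X in _ + X]mxE row_mxEr mxE.
case cd : (c (rshift n d)) => /= le_z; apply: near_lt_le.
- exact: (cS true).
- exact: (cS false).
- rewrite y0F cd mulr1
    (_ : (- _) y0 = - g (tagnat.sig1 d) (lsubmx y0) 0 (tagnat.sig2 d))//.
  by rewrite y0T (le_lt_trans le_z)// ltrDl.
- exact: (cS false).
- exact: (cS true).
- rewrite y0F cd mulrN1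
    (_ : (- _) y0 = - g (tagnat.sig1 d) (lsubmx y0) 0 (tagnat.sig2 d))//.
  by rewrite y0T (lt_le_trans _ le_z)// ltrBlDr ltrDl.
Unshelve. all: by end_near. Qed.

End KKT.

Theorem theorem8 (R : realType) (N : nat) (n_ m_ : 'I_N -> nat)
    (J : 'I_N -> 'rV[R]_(\sum_i n_ i) -> R)
    (g : forall i : 'I_N, 'rV[R]_(\sum_i n_ i) -> 'rV[R]_(m_ i))
    (J_smooth : forall i, C2_lip (J i))
    (g_smooth : forall i (j : 'I_(m_ i)), C2_lip (fun a => g i a 0 j))
    (zs : 'rV[R]_(\sum_i n_ i + \sum_i m_ i))
    (zs_sol : KKT J g zs = 0)
    (zs_qreg : quasi_regular (KKT J g) zs) :
  exists dz dr Lz Lr : R, [/\ 0 < dz, 0 < dr &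
    forall (z0 : 'rV[R]_(\sum_i n_ i + \sum_i m_ i))
           (r : nat -> 'rV[R]_(\sum_i n_ i + \sum_i m_ i)),
      enorm (z0 - zs) < dz ->
      (ereal_sup (range (fun k => (enorm (r k))%:E)) < dr%:E)%E ->
      newton_well_defined (KKT J g) r z0 /\
      forall z : nat -> 'rV[R]_(\sum_i n_ i + \sum_i m_ i),
        z 0%N = z0 ->
        (forall k, newton_step (KKT J g) (r k) (z k) (z k.+1)) ->
        forall k,
          enorm (z k.+1 - zs)
            <= Lz * enorm (z k - zs) ^+ 2 + Lr * enorm (r k)].
Proof.
move: zs_sol zs_qreg; rewrite KKT_minmap// => zs_sol zs_qreg.
have [K K0 KP] := newton_local_estimate
  (KKT_selection_C1_calm J_smooth g_smooth zs)
  (KKT_selection_branch_separable J_smooth g_smooth) zs_sol zs_qreg.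
have [dz [dr [Lz [Lr [dz0 dr0 conv]]]]] := newton_convergence K0 KP.
exists dz, dr, Lz, Lr; split=> // z0 r z0dz rdr; apply: conv => // k.
rewrite -lte_fin (le_lt_trans _ rdr)//.
by apply: ereal_sup_ubound; exists k.
Qed.
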